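(* Let $N\ge 1$, let $\Psi:\{0,1\}^N\to\mathbb{R}$ be a (bounded) function, let $p^0\in\,]0,1[^N$, and let $\lambda>0$. Let $G:\,]0,1[^N\to\mathbb{R}$ be the mean field objective associated with $\Psi$ and $p^0$, let $(Q^t)_{t\ge0}$ be the sequence generated from $Q^0=p^0$ by the proximal alternate minimization procedure with parameter $\lambda$ (see context), and let $\overline{Q}$ be its limit, which is a critical point of $G$. Let $\theta\in\,]0,1[$ be such that $G$ has the Kurdyka-Łojasiewicz property at $\overline{Q}$ with a function of the form $\phi(s)=cs^{1-\theta}$, $c>0$. (i) If $\theta\in\,]0,\tfrac12]$, then there exist $C\ge 0$ and $\tau\in[0,1[$ such that $\|Q^t-\overline{Q}\|\le C\tau^t$ for all $t\geq 0$. (ii) If $\theta\in\,]\tfrac12,1[$, then there exists $C\ge 0$ such that $\|Q^t-\overline{Q}\|\le C\,t^{-(1-\theta)/(2\theta-1)}$ for all $t\ge 1$. Moreover, if the Hessian of $G$ is positive definite at every local minimum of $G$, and $\overline{Q}$ is a local minimum of $G$, then the convergence is linear as in (i), with Kurdyka-Łojasiewicz exponent $\theta=\tfrac12$ at $\overline{Q}$.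
   Context: For $Q=(q_1,\dots,q_N)\in\,]0,1[^N$, let $E_Q$ denote expectation when $X=(X_1,\dots,X_N)$ has independent Bernoulli coordinates with $\mathrm{Prob}(X_i=1)=q_i$. Set $\Omega(Q)=E_Q(\Psi(X))=\sum_{x\in\{0,1\}^N}\Psi(x)\prod_i q_i^{x_i}(1-q_i)^{1-x_i}$, $f_i(q)=(1-q)\log\frac{1-q}{1-p^0_i}+q\log\frac{q}{p^0_i}$, and $G(Q)=\Omega(Q)+\sum_{i=1}^N f_i(q_i)$. For $q,q_0\in\,]0,1[$ let $l(q,q_0)=q\log\frac{q}{q_0}+(1-q)\log\frac{1-q}{1-q_0}$. Proximal alternate minimization procedure with parameter $\lambda>0$: start from $Q^0=p^0$; given $Q^t=(q^t_1,\dots,q^t_N)$, define $Q^{t+1}$ by computing successively for $i=1,\dots,N$ $$q^{t+1}_i=\operatorname*{arg\,min}_{q\in]0,1[}\ \{G(q^{t+1}_1,\dots,q^{t+1}_{i-1},q,q^t_{i+1},\dots,q^t_N)+\lambda\, l(q,q^t_i)\},$$ the minimizer being unique. The procedure is run indefinitely, and the resulting sequence converges to a critical point $\overline{Q}\in\,]0,1[^N$ of $G$. Kurdyka-Łojasiewicz property: a differentiable function $f$ has this property at $\overline{x}$ with function $\phi$ if there exist $\eta>0$ and a neighborhood $U$ of $\overline{x}$ such that $\phi:[0,\eta)\to\mathbb{R}_+$ is continuous and concave, $\phi(0)=0$, $\phi$ is $C^1$ on $(0,\eta)$ with $\phi'>0$ there, and $\phi'(f(x)-f(\overline{x}))\,\|\nabla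 f(x)\|\ge 1$ for all $x\in U$ with $f(\overline{x})<f(x)<f(\overline{x})+\eta$. Here $\|\cdot\|$ is the Euclidean norm. *)

(* Defs.v *)
From HB Require Import structures.
From mathcomp Require Import all_boot all_order all_algebra.
From mathcomp Require Import all_classical all_reals all_analysis.

Set Implicit Arguments.
Unset Strict Implicit.
Unset Printing Implicit Defensive.

Import Order.TTheory GRing.Theory Num.Theory.
Import numFieldNormedType.Exports.

Local Open Scope ring_scope.
Local Open Scope classical_set_scope.

Section Calculus.
Context {R : realType} {n : nat}.
Implicit Types (x y v : 'rV[R]_n) (D : set 'rV[R]_n) (f : 'rV[R]_n -> R).

(* The library norm `|x| on row vectors is the sup norm. It induces the same
   topology as the Euclidean norm, so nbhs, limits and differentiability are
   the usual ones. *)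
Definition norm2 x : R := Num.sqrt (\sum_(i < n) x 0 i ^+ 2).

Definition partial f (i : 'I_n) x : R := 'D_(delta_mx 0 i) f x.

Definition grad f x : 'rV[R]_n := \row_i partial f i x.

Definition hessian f x : 'M[R]_n :=
  \matrix_(i, j) partial (partial f j) i x.

Definition posdef (A : 'M[R]_n) :=
  forall v, v != 0 -> 0 < (v *m A *m v^T) 0 0.

(* In the notions below f is regarded as a function on the open set D; its
   values outside D are irrelevant. *)

Definition critical_point D f x := D x /\ grad f x = 0.

Definition local_min D f x := D x /\ \forall y \near x, D y -> f x <= f y.

(* Desingularizing functions on [0, eta[. Concavity of phi is convexity of
   - phi. *)
Definition desingularizing (eta : R) (phi : R -> R) :=
  [/\ forall s, 0 <= s < eta -> 0 <= phi s,
      {within `[0, eta[, continuous phi},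
      convex_function `[0, eta[%classic (fun s => - phi s),
      phi 0 = 0 &
      forall s, 0 < s < eta ->
        [/\ derivable phi s 1, {for s, continuous (derive1 phi)} & 0 < derive1 phi s]].

Definition KL_property D f x (phi : R -> R) :=
  [/\ D x,
      forall y, D y -> differentiable f y &
      exists2 eta : R, 0 < eta & desingularizing eta phi /\
        \forall y \near x, D y -> f x < f y < f x + eta ->
          1 <= derive1 phi (f y - f x) * norm2 (grad f y)].

Definition KL_exponent D f x (theta : R) :=
  exists2 c : R, 0 < c & KL_property D f x (fun s => c * s `^ (1 - theta)).

Definition linear_rate (u : nat -> 'rV[R]_n) x :=
  exists C tau : R, [/\ 0 <= C, 0 <= tau < 1 &
    forall t, norm2 (u t - x) <= C * tau ^+ t].

End Calculus.

Section MeanField.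
Context {R : realType} {N : nat}.
Implicit Types (Psi : {ffun 'I_N -> bool} -> R) (p P Q : 'rV[R]_N).

Definition cube : set 'rV[R]_N := [set Q | forall i, 0 < Q 0 i < 1].

(* E_Q(Psi(X)) for independent X_i ~ Bernoulli(q_i) *)
Definition Omega Psi Q : R :=
  \sum_(x : {ffun 'I_N -> bool})
    Psi x * \prod_(i < N) (Q 0 i ^+ x i * (1 - Q 0 i) ^+ (~~ x i)).

Definition bernoulli_kl (q q0 : R) : R :=
  q * ln (q / q0) + (1 - q) * ln ((1 - q) / (1 - q0)).

(* The i-th penalty f_i(q) is bernoulli_kl q (p 0 i). *)
Definition G Psi p Q : R :=
  Omega Psi Q + \sum_(i < N) bernoulli_kl (Q 0 i) (p 0 i).

(* (P_1, ..., P_(i-1), q, Q_(i+1), ..., Q_N) *)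
Definition splice P Q (i : 'I_N) (q : R) : 'rV[R]_N :=
  \row_j (if (j < i)%N then P 0 j else if j == i then q else Q 0 j).

Definition is_argmin (D : set R) (h : R -> R) (q : R) :=
  D q /\ forall q', D q' -> h q <= h q'.

(* The minimizer is unique, so this determines Q. *)
Definition proximal_sequence Psi p (lambda : R) (Q : nat -> 'rV[R]_N) :=
  Q 0%N = p /\
  forall t (i : 'I_N),
    is_argmin `]0, 1[%classic
      (fun q => G Psi p (splice (Q t.+1) (Q t) i q)
                + lambda * bernoulli_kl q (Q t 0 i))
      (Q t.+1 0 i).

End MeanField.

(* Main.v *)
Require Import Defs.
From HB Require Import structures.
From mathcomp Require Import all_boot all_order all_algebra.
From mathcomp Require Import all_classical all_reals all_analysis.
From mathcomp Require Import ring lra.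

Set Implicit Arguments.
Unset Strict Implicit.
Unset Printing Implicit Defensive.

Import Order.TTheory GRing.Theory Num.Theory.
Import numFieldNormedType.Exports.

Local Open Scope ring_scope.
Local Open Scope classical_set_scope.

(** Each coordinate step of the procedure gives two estimates. Comparing the
    minimizer with the previous value, and bounding l(q, q0) below by a multiple
    of (q - q0)^2, yields the sufficient decrease
    (lambda / 4) |Q^(t+1) - Q^t|^2 <= G(Q^t) - G(Q^(t+1)). The first-order
    condition yields |grad G(Q^(t+1))| <= K |Q^(t+1) - Q^t| as soon as the
    iterates stay away from the faces of the cube. With r_t = G(Q^t) - G(Qbar)
    the Kurdyka-Lojasiewicz inequality becomes r_(t+1)^theta <= b d_t, where
    d_t = |Q^(t+1) - Q^t|, and concavity of s^(1-theta) makes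
    E_t = d_t + k r_(t+1)^(1-theta) satisfy d_(t+1) <= E_t - E_(t+1). Hence
    |Q^(t+1) - Qbar| <= E_t = O(r_t^(1-theta)) for theta >= 1/2, and an exponent
    below 1/2 may be replaced by 1/2. The recurrence
    r_(t+1)^(2 theta) <= M (r_t - r_(t+1)) then gives geometric decay of r_t when
    theta = 1/2 and linear growth of r_t^(1 - 2 theta) when theta > 1/2.
    Finally, an invertible Hessian at a critical point already forces the
    Kurdyka-Lojasiewicz exponent 1/2. *)

(** * Power functions and rates *)

Section RealInequalities.
Context {R : realType}.
Implicit Types a b x s : R.

Lemma ln_le_sub1 x : 0 < x -> ln x <= x - 1.
Proof. by move=> x0; rewrite -[x in ln x](subrKC 1) le_ln1Dx// ltrBrDl subrr. Qed.

Lemma powR_le_tangent1 x s : 0 <= x -> 0 < s < 1 -> x `^ s <= 1 + s * (x - 1).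
Proof.
move=> x0 /andP[s0 s1].
have := @conjugate_powR R (x `^ s) 1 s^-1 (1 - s)^-1 (powR_ge0 _ _) ler01.
rewrite !invr_gt0 subr_gt0 !invrK => /(_ s0 s1 (subrKC _ _)).
rewrite mulr1 -powRrM mulfV ?gt_eqF// powRr1// powR1 mul1r => /le_trans; apply.
lra.
Qed.

Lemma powR_concave_tangent a b s : 0 < a -> 0 < b -> 0 < s < 1 ->
  s * a `^ (s - 1) * (a - b) <= a `^ s - b `^ s.
Proof.
move=> a0 b0 s01.
have ba0 : 0 <= b / a by rewrite divr_ge0// ltW.
have H := powR_le_tangent1 ba0 s01.
have -> : b `^ s = (b / a) `^ s * a `^ s by rewrite -powRM ?divfK ?gt_eqF// ltW.
have as0 : 0 < a `^ s by rewrite powR_gt0.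
have := ler_wpM2r (ltW as0) H.
have -> : a `^ (s - 1) = a `^ s / a.
  by rewrite powRB ?powRr1 ?(gt_eqF a0) ?implybT// ltW.
suff -> : s * (a `^ s / a) * (a - b) = a `^ s - (1 + s * (b / a - 1)) * a `^ s by lra.
by field; rewrite gt_eqF.
Qed.

(** Write (b/a)^(-s) as exp(-s ln(b/a)), then use exp y >= 1 + y and ln y <= y - 1. *)
Lemma powRN_convex_tangent a b s : 0 < a -> 0 < b -> 0 <= s ->
  a `^ (- s) * (1 + s * (1 - b / a)) <= b `^ (- s).
Proof.
move=> a0 b0 s0; have ba0 : 0 < b / a by rewrite divr_gt0.
have -> : b `^ (- s) = a `^ (- s) * (b / a) `^ (- s).
  by rewrite -powRM ?ltW// mulrC divfK ?gt_eqF.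
rewrite ler_wpM2l ?powR_ge0// /powR gt_eqF// (le_trans _ (expR_ge1Dx _))//.
by rewrite lerD2l mulNr -mulrN ler_wpM2l// lerNr opprB ln_le_sub1.
Qed.

(** The finitely many early indices are absorbed into the constant through the ratios a/b. The
    starting index [m] allows rates t^(-beta), which are not positive at t = 0. *)
Lemma eventually_le_all (a b : nat -> R) (C : R) (m : nat) :
  (forall t, (m <= t)%N -> 0 < b t) ->
  (\forall t \near \oo, a t <= C * b t) ->
  exists2 C' : R, 0 <= C' & forall t, (m <= t)%N -> a t <= C' * b t.
Proof.
move=> b0 [T _ aT]; exists (`|C| + \sum_(s < T) `|a s / b s|).
  by rewrite addr_ge0// sumr_ge0.
move=> t mt; have bt := b0 _ mt; have [Tt|tT] := leqP T t.
  rewrite (le_trans (aT _ Tt))// ler_wpM2r ?(ltW bt)//.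
  by rewrite (le_trans (ler_norm _))// lerDl sumr_ge0.
rewrite -ler_pdivrMr// (bigD1 (Ordinal tT))//= addrCA.
by rewrite (le_trans (ler_norm _))// lerDl addr_ge0// sumr_ge0.
Qed.

End RealInequalities.

Section Rates.
Context {R : realType}.
Variable r : nat -> R.

Lemma geometric_decrease (M : R) : 0 < M -> (forall t, 0 < r t) ->
  (forall t, r t.+1 <= M * (r t - r t.+1)) ->
  forall t, r t <= r 0 * (M / (1 + M)) ^+ t.
Proof.
move=> M0 r0 rM; elim=> [|t IH]; first by rewrite expr0 mulr1.
have M1 : 0 < 1 + M by rewrite addr_gt0.
rewrite exprSr mulrA (@le_trans _ _ (r t * (M / (1 + M))))//.
  by rewrite mulrA ler_pdivlMr//; have := rM t; lra.
by rewrite ler_wpM2r// divr_ge0// ltW.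
Qed.

Lemma sublinear_decrease (alpha M : R) : 0 < alpha -> 0 < M ->
  (forall t, 0 < r t <= 1) -> (forall t, r t.+1 <= r t) ->
  (forall t, r t.+1 `^ (1 + alpha) <= M * (r t - r t.+1)) ->
  exists2 mu : R, 0 < mu & forall t, mu * t%:R <= r t `^ (- alpha).
Proof.
move=> a0 M0 r01 rdec rM.
(* Minimal growth of r^(-alpha) in one step: [mu1] when r loses at most half its value, so that the
   recurrence bounds the loss from below, and [mu2] when r more than halves. *)
pose mu1 := alpha * 2^-1 `^ (1 + alpha) / M.
pose mu2 : R := alpha / 2.
have h0 : (0 : R) < 2^-1 by rewrite invr_gt0.
have mu10 : 0 < mu1 by rewrite divr_gt0// mulr_gt0// powR_gt0.
have mu20 : 0 < mu2 by rewrite divr_gt0.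
exists (Num.min mu1 mu2); first by rewrite lt_min mu10.
set mu := Num.min _ _.
suff step t : mu + r t `^ (- alpha) <= r t.+1 `^ (- alpha).
  elim=> [|t IH]; first by rewrite mulr0 powR_ge0.
  by rewrite -natr1 mulrDr mulr1 addrC (le_trans _ (step t))// lerD2l.
have /andP[rt0 rt1] := r01 t; have /andP[rs0 rs1] := r01 t.+1.
(* The bound r <= 1 enters here; it makes the gain in the halving case at least alpha/2. *)
have ra1 : 1 <= r t `^ (- alpha).
  have e1 : 1 = 1 `^ alpha :> R by rewrite powR1.
  rewrite powRN invf_ge1 ?powR_gt0// [leRHS]e1.
  by apply: (ge0_ler_powR (ltW a0)); rewrite ?nnegrE// ltW.
have := powRN_convex_tangent rt0 rs0 (ltW a0).
set A := r t `^ (- alpha) in ra1 *.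
rewrite mulrDr mulr1 addrC => /(le_trans _); apply; rewrite lerD2r.
have [big|small] := leP (r t / 2) (r t.+1); last first.
  rewrite ge_min; apply/orP; right.
  have : r t.+1 / r t <= 2^-1 by rewrite ler_pdivrMr// mulrC ltW.
  move=> q; apply: (@le_trans _ _ (alpha * (1 - r t.+1 / r t))).
    by rewrite /mu2 ler_wpM2l ?(ltW a0)//; lra.
  by rewrite ler_peMl// mulr_ge0 ?(ltW a0)// subr_ge0 (le_trans q)// invf_le1// ler1n.
rewrite ge_min; apply/orP; left.
have e1 : 2^-1 `^ (1 + alpha) * r t `^ (1 + alpha) <= M * (r t - r t.+1).
  apply: le_trans (rM t); rewrite -powRM ?(ltW h0) ?(ltW rt0)//.
  have a1 : 0 <= 1 + alpha by rewrite addr_ge0// ltW.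
  by apply: (ge0_ler_powR a1); rewrite ?nnegrE ?mulr_ge0 ?(ltW rt0) ?(ltW rs0)// mulrC.
have eA : A = (r t `^ (1 + alpha))^-1 * r t.
  rewrite powRD ?(gt_eqF rt0) ?implybT// powRr1 ?ltW// /A powRN; field.
  by rewrite !gt_eqF// powR_gt0.
have -> : A * (alpha * (1 - r t.+1 / r t)) =
   alpha / M * (M * (r t - r t.+1)) / r t `^ (1 + alpha).
  by rewrite eA; field; rewrite !gt_eqF// powR_gt0.
rewrite ler_pdivlMr ?powR_gt0// /mu1.
rewrite [leLHS](_ : _ = alpha / M * (2^-1 `^ (1 + alpha) * r t `^ (1 + alpha))).
  by rewrite ler_wpM2l// divr_ge0 ?ltW.
by ring.
Qed.

End Rates.

(** * Descent sequences under a Kurdyka-Lojasiewicz inequality *)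

Section KLDescent.
Context {R : realType} {V : normedModType R}.
Variables (u : nat -> V) (x : V) (r : nat -> R) (a b theta : R).
Hypotheses (a0 : 0 < a) (b0 : 0 < b) (theta12 : 1 / 2 <= theta < 1).
Hypothesis ux : u @ \oo --> x.
Hypothesis r01 : forall t, 0 < r t <= 1.
Hypothesis decrease : forall t, a * `|u t.+1 - u t| ^+ 2 <= r t - r t.+1.
Hypothesis kl : forall t, r t.+1 `^ theta <= b * `|u t.+1 - u t|.

Let r_decr t : r t.+1 <= r t.
Proof.
by rewrite -subr_ge0 (le_trans _ (decrease t))// mulr_ge0 ?exprn_ge0// ltW.
Qed.

Lemma KL_distance_bound :
  exists2 C : R, 0 <= C & forall t, `|u t.+1 - x| <= C * r t `^ (1 - theta).
Proof.
have /andP[t12 t1] := theta12.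
have ot0 : 0 < 1 - theta by lra.
pose k := b / (a * (1 - theta)).
have k0 : 0 < k by rewrite divr_gt0// mulr_gt0.
pose d t := `|u t.+1 - u t|.
pose phi t := r t `^ (1 - theta).
have step t : 2 * d t.+1 <= d t + k * (phi t.+1 - phi t.+2).
  have /andP[rt0 _] := r01 t.+1; have /andP[rs0 _] := r01 t.+2.
  (* By [kl], a positive gap forces a nonzero step, so division by [d t] is legitimate. *)
  have d0 : 0 < d t.
    by rewrite -(pmulr_rgt0 _ b0) (lt_le_trans _ (kl t))// powR_gt0.
  have ot1 : 0 < 1 - theta < 1 by apply/andP; split; lra.
  have := powR_concave_tangent rt0 rs0 ot1.
  rewrite -/(phi _) -/(phi _) addrAC subrr sub0r => conc.
  have inv : (b * d t)^-1 <= r t.+1 `^ (- theta).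
    by rewrite powRN lef_pV2 ?posrE ?powR_gt0 ?mulr_gt0//; exact: kl.
  have : (1 - theta) * (b * d t)^-1 * (a * d t.+1 ^+ 2) <= phi t.+1 - phi t.+2.
    apply: le_trans conc; apply: ler_pM.
    - by apply: mulr_ge0; rewrite ?invr_ge0 ?ltW ?mulr_gt0.
    - by apply: mulr_ge0; rewrite ?sqr_ge0 ?ltW.
    - by apply: ler_wpM2l => //; rewrite ltW.
    - exact: decrease.
  set z := phi _ - _ => zle.
  have dle : d t.+1 ^+ 2 <= d t * (k * z).
    have kd0 : 0 <= d t * k by rewrite mulr_ge0// ltW.
    have := ler_wpM2l kd0 zle; rewrite -[d t * k * z]mulrA.
    rewrite [leLHS](_ : _ = d t.+1 ^+ 2)//.
    by rewrite /k; field; rewrite !gt_eqF.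
  have z0 : 0 <= k * z.
    by rewrite -(pmulr_rge0 _ d0) (le_trans _ dle)// sqr_ge0.
  (* AM-GM applied to [d t] and [k * z] *)
  rewrite -(@ler_pXn2r _ 2)// ?nnegrE; last 2 first.
  - by apply: mulr_ge0 => //; exact: normr_ge0.
  - by apply: addr_ge0 => //; exact: ltW.
  have := sqr_ge0 (d t - k * z); rewrite !exprMn !(sqrrB, sqrrD); lra.
(* Moving one copy of d_(t+1) across [step] gives d_(t+1) <= E_t - E_(t+1), which telescopes. *)
pose E t := d t + k * phi t.+1.
have dist t m : `|u (t.+1 + m)%N - u t.+1| <= E t - E (t + m)%N.
  elim: m => [|m IH]; first by rewrite !addn0 !subrr normr0.
  have -> : u (t.+1 + m.+1)%N - u t.+1 =
    (u (t + m).+2 - u (t + m).+1) + (u (t.+1 + m)%N - u t.+1).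
    by rewrite addnS addSn addrA subrK.
  rewrite (le_trans (ler_normD _ _))// addnS.
  by have := step (t + m)%N; move: IH; rewrite /E -/(d _); lra.
have E0 t : 0 <= E t by apply: addr_ge0; rewrite ?normr_ge0// mulr_ge0 ?powR_ge0// ltW.
have distx t : `|u t.+1 - x| <= E t.
  have cv : `|u (m + t.+1)%N - u t.+1| @[m --> \oo] --> `|x - u t.+1|.
    by apply: cvg_norm; apply: cvgB; [rewrite cvg_shiftn|exact: cvg_cst].
  rewrite distrC -(cvg_lim _ cv)//; apply: limr_le; first by apply/cvg_ex; eexists; exact: cv.
  apply: nearW => m; rewrite addnC (le_trans (dist t m))//.
  by rewrite gerBl.
(* The first summand comes from d_t <= sqrt(r_t / a) together with sqrt(r_t) <= r_t^(1-theta), which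
   holds because r_t <= 1 and theta >= 1/2. *)
exists ((Num.sqrt a)^-1 + k); first by rewrite addr_ge0 ?invr_ge0 ?sqrtr_ge0// ltW.
move=> t; apply: (le_trans (distx t)).
have /andP[rt0 rt1] := r01 t; have /andP[rs0 _] := r01 t.+1.
rewrite /E mulrDl lerD//; last first.
  rewrite ler_wpM2l ?(ltW k0)// /phi.
  by apply: (ge0_ler_powR (ltW ot0)); rewrite ?nnegrE ?(ltW rt0) ?(ltW rs0).
have sa0 : 0 < Num.sqrt a by rewrite sqrtr_gt0.
rewrite ler_pdivlMl//; apply: (@le_trans _ _ (Num.sqrt (r t))).
  rewrite -(@ler_pXn2r _ 2)// ?nnegrE ?mulr_ge0 ?sqrtr_ge0 ?normr_ge0//.
  rewrite exprMn !sqr_sqrtr ?(ltW a0) ?(ltW rt0)//.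
  by rewrite (le_trans (decrease t))// gerBl ltW.
rewrite -powR12_sqrt ?(ltW rt0)//.
by apply: ger_powR; [rewrite rt0|lra].
Qed.

(** Squaring [kl] and bounding the squared step by [decrease] eliminates the step length. *)
Let recurrence t : r t.+1 `^ (2 * theta) <= b ^+ 2 / a * (r t - r t.+1).
Proof.
rewrite mulrC powRrM powR_mulrn ?powR_ge0//.
apply: (@le_trans _ _ (b ^+ 2 * `|u t.+1 - u t| ^+ 2)).
  rewrite -exprMn lerXn2r ?nnegrE ?powR_ge0//.
  by rewrite mulr_ge0// ltW.
by rewrite -mulrA ler_wpM2l ?exprn_ge0 ?(ltW b0)// ler_pdivlMl//.
Qed.

(** At theta = 1/2 the distance is controlled by the square root of a geometrically decaying gap.
    The strict bound 0 < tau allows a later shift of the index to be undone by dividing by a power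
    of tau. *)
Lemma KL_linear_rate : theta = 1 / 2 -> exists C tau : R,
  [/\ 0 <= C, 0 < tau < 1 & forall t, `|u t.+1 - x| <= C * tau ^+ t].
Proof.
move=> th; have [C C0 uC] := KL_distance_bound.
have M0 : 0 < b ^+ 2 / a by rewrite divr_gt0// exprn_gt0.
have r0 t : 0 < r t by case/andP: (r01 t).
pose M := b ^+ 2 / a.
have rM t : r t.+1 <= M * (r t - r t.+1).
  rewrite /M; have := recurrence t; rewrite th (_ : 2 * (1 / 2) = 1) ?powRr1 ?(ltW (r0 _))//.
  lra.
have geo := geometric_decrease M0 r0 rM.
have M1 : 0 < 1 + M by rewrite addr_gt0.
set rho := M / (1 + M) in geo.
have rho0 : 0 < rho by rewrite divr_gt0.
have rho1 : rho < 1 by rewrite /rho ltr_pdivrMr// mul1r ltrDr.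
exists (C * Num.sqrt (r 0)), (Num.sqrt rho); split.
- by rewrite mulr_ge0 ?sqrtr_ge0.
- by rewrite sqrtr_gt0 rho0 -[ltRHS]sqrtr1 ltr_sqrt.
move=> t; apply: (le_trans (uC t)); rewrite -mulrA ler_wpM2l//.
have -> : 1 - theta = 2^-1 by rewrite th; lra.
rewrite powR12_sqrt ?(ltW (r0 t))// -(@ler_pXn2r _ 2)// ?nnegrE ?mulr_ge0 ?exprn_ge0 ?sqrtr_ge0//.
by rewrite exprMn exprAC !sqr_sqrtr ?(ltW (r0 _)) ?(ltW rho0).
Qed.

Lemma KL_sublinear_rate : 1 / 2 < theta -> exists2 C : R, 0 <= C &
  forall t, (0 < t)%N ->
    `|u t.+1 - x| <= C * t%:R `^ (- ((1 - theta) / (2 * theta - 1))).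
Proof.
move=> th; have [C C0 uC] := KL_distance_bound.
have /andP[_ t1] := theta12.
have M0 : 0 < b ^+ 2 / a by rewrite divr_gt0// exprn_gt0.
have al0 : 0 < 2 * theta - 1 by lra.
have rM t : r t.+1 `^ (1 + (2 * theta - 1)) <= b ^+ 2 / a * (r t - r t.+1).
  by rewrite (subrKC 1); exact: recurrence.
have [mu mu0 murt] := sublinear_decrease al0 M0 r01 r_decr rM.
set al := 2 * theta - 1 in al0 murt *.
set be := (1 - theta) / al.
have be0 : 0 < be by rewrite divr_gt0//; lra.
exists (C * mu `^ (- be)); first by rewrite mulr_ge0 ?powR_ge0.
move=> t t0; apply: (le_trans (uC t)); rewrite -mulrA ler_wpM2l//.
have /andP[rt0 _] := r01 t.
have tR : (0 : R) < t%:R by rewrite ltr0n.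
rewrite -powRM ?(ltW mu0) ?(ltW tR)//.
(* The exponent (1-theta)/(2 theta - 1) arises here: the linear lower bound on r^(-al) is raised to
   the power -be. *)
have -> : r t `^ (1 - theta) = (r t `^ (- al)) `^ (- be).
  by rewrite -powRrM mulrNN /be mulrCA mulfV ?mulr1// gt_eqF.
rewrite !(powRN _ be) lef_pV2 ?posrE ?powR_gt0 ?mulr_gt0//.
apply: (ge0_ler_powR (ltW be0)); rewrite ?nnegrE ?powR_ge0//.
by rewrite mulr_ge0// ltW.
Qed.

End KLDescent.

(** * Norms, lines and the Bernoulli divergence *)

Section RowNorms.
Context {R : realType} {n : nat}.
Implicit Types x y : 'rV[R]_n.

Lemma normr_coord x i : `|x 0 i| <= `|x|.
Proof.
rewrite [leRHS]mx_normrE.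
exact: (le_bigmax _ (fun ij : 'I_1 * 'I_n => `|x ij.1 ij.2|) (0, i)).
Qed.

Lemma normr_row_le x (c : R) : 0 <= c -> (forall i, `|x 0 i| <= c) -> `|x| <= c.
Proof.
move=> c0 xc; rewrite [leLHS]mx_normrE; apply: bigmax_le => // -[i j] _ /=.
by rewrite (ord1 i).
Qed.

Lemma sum_sqr_ge0 x : 0 <= \sum_(i < n) x 0 i ^+ 2.
Proof. by apply: sumr_ge0 => i _; exact: sqr_ge0. Qed.

Lemma norm2_ge0 x : 0 <= norm2 x.
Proof. exact: sqrtr_ge0. Qed.

Lemma norm2_coord x i : `|x 0 i| <= norm2 x.
Proof.
rewrite -sqrtr_sqr ler_sqrt ?sum_sqr_ge0// (bigD1 i)//= lerDl.
by apply: sumr_ge0 => j _; exact: sqr_ge0.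
Qed.

Lemma normr_le_norm2 x : `|x| <= norm2 x.
Proof. by apply: normr_row_le; [exact: norm2_ge0|exact: norm2_coord]. Qed.

Lemma norm2_le x : norm2 x <= Num.sqrt n%:R * `|x|.
Proof.
rewrite -(@ler_pXn2r _ 2)// ?nnegrE ?norm2_ge0 ?mulr_ge0 ?sqrtr_ge0//.
rewrite exprMn !sqr_sqrtr ?sum_sqr_ge0// mulr_natl -[n in _ *+ n]card_ord -sumr_const.
apply: ler_sum => i _; rewrite -real_normK ?num_real//.
by rewrite lerXn2r ?nnegrE ?normr_coord.
Qed.

End RowNorms.

Section Lines.
Context {R : realType} {n : nat}.
Implicit Types (f : 'rV[R]_n -> R) (x v : 'rV[R]_n).

(** Both difference quotients are the same function of h. One direction turns coordinate derivatives
    into partial derivatives, the other prepares the mean value theorem on a segment. *)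
Lemma is_derive_line f x v (s d : R) :
  is_derive s (1 : R) (fun h : R => f (h *: v + x)) d <->
  is_derive (s *: v + x) v f d.
Proof.
set g := fun h : R => f (h *: v + x).
have E : (fun h : R => h^-1 *: (f ((h *: (1 : R) + s) *: v + x) - f (s *: v + x))) =
         (fun h : R => h^-1 *: (f (h *: v + (s *: v + x)) - f (s *: v + x))).
  by apply/funext => h; rewrite [h *: 1]mulr1 scalerDl addrA.
have D1 : derivable g s 1 = derivable f (s *: v + x) v by rewrite /derivable E.
have D2 : 'D_1 g s = 'D_v f (s *: v + x) by rewrite /derive E.
split=> -[df <-]; apply: DeriveDef.
- by move: df; rewrite D1.
- exact: esym D2.
- by rewrite D1.
- exact: D2.
Qed.

Lemma diff_partial f x v : differentiable f x ->
  'd f x v = \sum_(i < n) v 0 i * partial f i x.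
Proof.
move=> df; rewrite {1}(row_sum_delta v) linear_sum; apply: eq_bigr => i _.
by rewrite linearZ /partial deriveE.
Qed.

End Lines.

Section BernoulliKL.
Context {R : realType}.
Implicit Types q : R.

(** The derivative of [bernoulli_kl] in its first argument is a difference of two values of this
    function. *)
Definition logit q : R := ln q - ln (1 - q).

Lemma bernoulli_kl_self q : 0 < q < 1 -> bernoulli_kl q q = 0.
Proof.
move=> /andP[q0 q1].
by rewrite /bernoulli_kl !mulfV ?subr_eq0 ?(gt_eqF q0) ?(gt_eqF q1)// ln1 !mulr0 addr0.
Qed.

(** Taking square roots before applying ln y <= y - 1 is essential: applied to q0/q directly, the
    bounds for q and 1 - q would add up to 0 only, whereas here they add up to a squared
    distance. *)
Lemma entropy_term_ge (q q0 : R) : 0 < q -> 0 < q0 ->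
  2 * (q - Num.sqrt q * Num.sqrt q0) <= q * ln (q / q0).
Proof.
move=> h h0; set a := Num.sqrt q; set a0 := Num.sqrt q0.
have ha : 0 < a by rewrite sqrtr_gt0.
have ha0 : 0 < a0 by rewrite sqrtr_gt0.
have qE : q = a ^+ 2 by rewrite sqr_sqrtr ?ltW.
have q0E : q0 = a0 ^+ 2 by rewrite sqr_sqrtr ?ltW.
have r0 : 0 < a0 / a by rewrite divr_gt0.
have -> : ln (q / q0) = - 2 * ln (a0 / a).
  rewrite [in LHS]qE q0E -invf_div -expr_div_n lnV ?posrE ?exprn_gt0// lnXn//.
  by rewrite mulNr mulr_natl.
have := ler_wpM2l (ltW h) (ln_le_sub1 r0).
rewrite [X in _ <= X -> _](_ : _ = a * a0 - q); first lra.
by rewrite qE; field; rewrite gt_eqF.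
Qed.

(* Compares both sides with the squared Hellinger distance, using
   ln y <= y - 1 at y = sqrt (q0 / q). *)
Lemma bernoulli_kl_ge (q q0 : R) : 0 < q < 1 -> 0 < q0 < 1 ->
  (q - q0) ^+ 2 / 4 <= bernoulli_kl q q0.
Proof.
move=> /andP[h h1] /andP[k k1].
have h' : 0 < 1 - q by lra.
have k' : 0 < 1 - q0 by lra.
have a1 : Num.sqrt q <= 1 by rewrite -[leRHS]sqrtr1 ler_sqrt// ltW.
have a01 : Num.sqrt q0 <= 1 by rewrite -[leRHS]sqrtr1 ler_sqrt// ltW.
have A := entropy_term_ge h k; have B := entropy_term_ge h' k'.
rewrite /bernoulli_kl.
have sq (y : R) : 0 < y -> y = Num.sqrt y ^+ 2 by move=> ?; rewrite sqr_sqrtr ?ltW.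
have := sq _ h; have := sq _ k; have := sq _ h'; have := sq _ k'.
have := sqrtr_ge0 q; have := sqrtr_ge0 q0.
set a := Num.sqrt q in A a1 *; set a0 := Num.sqrt q0 in A a01 *.
set b := Num.sqrt (1 - q) in B *; set b0 := Num.sqrt (1 - q0) in B *.
move=> a00 aa0 eb0 eb ea0 ea.
(* Here q - q0 = (a - a0)(a + a0) with a + a0 <= 2, whence the constant 4. *)
have H : (q - q0) ^+ 2 / 4 <= (a - a0) ^+ 2.
  rewrite ea ea0 subr_sqr exprMn -mulrA ler_piMr ?sqr_ge0//.
  rewrite ler_pdivrMr// mul1r [leRHS](_ : 4 = 2 ^+ 2); last by ring.
  by rewrite lerXn2r ?nnegrE ?addr_ge0//; lra.
apply: (le_trans H); have := sqr_ge0 (b - b0); rewrite !sqrrB; lra.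
Qed.

Lemma is_derive_bernoulli_kl (q q0 : R) : 0 < q < 1 -> 0 < q0 < 1 ->
  is_derive q (1 : R) (fun q => bernoulli_kl q q0) (logit q - logit q0).
Proof.
move=> /andP[h h1] /andP[k k1].
have h' : 0 < 1 - q by lra.
have k' : 0 < 1 - q0 by lra.
(* Splitting the logarithms of quotients is valid only where both arguments are positive, hence the
   passage through a function equal near q. *)
pose g (q : R) : R := q * (ln q - ln q0) + (1 - q) * (ln (1 - q) - ln (1 - q0)).
have gE : \forall z \near q, g z = bernoulli_kl z q0.
  near=> z; have z0 : 0 < z by near: z; exact: lt_nbhsr.
  have z1 : 0 < 1 - z by rewrite subr_gt0; near: z; exact: lt_nbhsl.
  by rewrite /g /bernoulli_kl !ln_div.
apply: (near_eq_is_derive gE).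
have d1 : is_derive q (1 : R) (@ln R) q^-1 by exact: is_derive1_ln.
have d2 : is_derive q (1 : R) (fun q : R => ln (1 - q)) (- (1 - q)^-1).
  have d3 : is_derive (1 - q) (1 : R) (@ln R) (1 - q)^-1 by exact: is_derive1_ln.
  have d4 : is_derive q (1 : R) (fun q : R => 1 - q) (0 - 1).
    by apply: is_deriveB.
  by have := @is_derive1_comp R (@ln R) (fun q : R => 1 - q) q _ _ d3 d4; rewrite sub0r mulrN1.
rewrite /g.
apply: is_derive_eq.
by rewrite /logit /GRing.scale/=; field; rewrite !gt_eqF.
Unshelve. all: by end_near.
Qed.

(** On [delta, +oo[ the logarithm is 1/delta-Lipschitz, and [logit] is a difference of two
    logarithms. This is why the iterates must stay away from the faces of the cube. *)
Lemma logit_lipschitz (delta q q0 : R) : 0 < delta ->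
  delta <= q <= 1 - delta -> delta <= q0 <= 1 - delta ->
  `|logit q - logit q0| <= 2 / delta * `|q - q0|.
Proof.
move=> d0.
have ln_lip (a b : R) : delta <= a -> delta <= b -> ln a - ln b <= delta^-1 * `|a - b|.
  move=> da db; have a0 := lt_le_trans d0 da; have b0 := lt_le_trans d0 db.
  rewrite -ln_div// (le_trans (ln_le_sub1 _)) ?divr_gt0//.
  have -> : a / b - 1 = b^-1 * (a - b) by field; rewrite gt_eqF.
  apply: (@le_trans _ _ (b^-1 * `|a - b|)).
    by rewrite ler_wpM2l ?invr_ge0 ?(ltW b0)// ler_norm.
  by rewrite ler_wpM2r// lef_pV2.
move=> /andP[q1 q2] /andP[q3 q4].
have q2' : delta <= 1 - q by lra.
have q4' : delta <= 1 - q0 by lra.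
have := ln_lip _ _ q1 q3; have := ln_lip _ _ q3 q1.
have := ln_lip _ _ q2' q4'; have := ln_lip _ _ q4' q2'.
have -> : 1 - q - (1 - q0) = q0 - q by lra.
have -> : 1 - q0 - (1 - q) = q - q0 by lra.
rewrite /logit (distrC q0 q) ler_norml -mulrA mulr_natl mulr2n.
set z := delta^-1 * _; lra.
Qed.

End BernoulliKL.

(** * Calculus of the mean field objective *)

Section ProductLemmas.
Context {R : realType}.

(** Factors are exchanged one at a time, the remaining products being bounded by 1. *)
Lemma norm_prod_diff_le (I : Type) (r : seq I) (F H : I -> R) :
  (forall i, `|F i| <= 1) -> (forall i, `|H i| <= 1) ->
  `|\prod_(i <- r) F i - \prod_(i <- r) H i| <= \sum_(i <- r) `|F i - H i|.
Proof.
move=> F1 H1; elim: r => [|i r IH]; first by rewrite !big_nil subrr normr0.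
rewrite !big_cons; set f := \prod_(j <- r) F j in IH *.
set h := \prod_(j <- r) H j in IH *.
have -> : F i * f - H i * h = F i * (f - h) + (F i - H i) * h by ring.
rewrite (le_trans (ler_normD _ _))// addrC !normrM; apply: lerD; last first.
  by rewrite (le_trans _ IH)// ler_piMl.
rewrite ler_piMr// normr_prod prodr_ile1// => j _.
by rewrite normr_ge0 H1.
Qed.

Lemma differentiable_bigop_sum (V : normedModType R) (I : Type) (r : seq I)
    (F : I -> V -> R) (x : V) : (forall i, differentiable (F i) x) ->
  differentiable (fun y => \sum_(i <- r) F i y) x.
Proof.
move=> dF; elim: r => [|i r IH].
  by under eq_fun do rewrite big_nil; exact: differentiable_cst.
by under eq_fun do rewrite big_cons; exact: differentiableD.
Qed.

Lemma differentiable_bigop_prod (V : normedModType R) (I : Type) (r : seq I)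
    (F : I -> V -> R) (x : V) : (forall i, differentiable (F i) x) ->
  differentiable (fun y => \prod_(i <- r) F i y) x.
Proof.
move=> dF; elim: r => [|i r IH].
  by under eq_fun do rewrite big_nil; exact: differentiable_cst.
by under eq_fun do rewrite big_cons; exact: differentiableM.
Qed.

End ProductLemmas.

Section MeanFieldCalculus.
Context {R : realType} {N : nat}.
Implicit Types (Psi : {ffun 'I_N -> bool} -> R) (p P Q x y : 'rV[R]_N).
Implicit Types (i j : 'I_N) (q : R).

Definition setc Q i q : 'rV[R]_N := \row_j (if j == i then q else Q 0 j).

Lemma setc_at Q i q : setc Q i q 0 i = q.
Proof. by rewrite mxE eqxx. Qed.

Lemma setc_neq Q i j q : j != i -> setc Q i q 0 j = Q 0 j.
Proof. by rewrite mxE => /negbTE ->. Qed.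

Lemma setc_id Q i : setc Q i (Q 0 i) = Q.
Proof. by apply/rowP => j; rewrite mxE; case: eqP => // ->. Qed.

Lemma setc_line Q i q : setc Q i q = q *: delta_mx 0 i + setc Q i 0.
Proof.
apply/rowP => j; rewrite !mxE eqxx/=.
by case: eqP; rewrite ?mulr1 ?mulr0 ?addr0 ?add0r.
Qed.

Lemma setc_splice P Q i q q' : setc (splice P Q i q) i q' = splice P Q i q'.
Proof.
by apply/rowP => j; rewrite !mxE; case: eqP => // ->; rewrite ltnn.
Qed.

(* Omega is affine in each coordinate, so this is its i-th partial derivative. *)
Definition dOmega Psi i Q : R := Omega Psi (setc Q i 1) - Omega Psi (setc Q i 0).

(** In each product only the factor of index i depends on q, and it equals q or 1 - q. *)
Lemma Omega_setc Psi Q i q :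
  Omega Psi (setc Q i q) = Omega Psi (setc Q i 0) + q * dOmega Psi i Q.
Proof.
rewrite /dOmega /Omega -sumrB mulr_sumr -big_split/=; apply: eq_bigr => x _.
rewrite !(bigD1 i (P := xpredT))//= !setc_at.
have rest b : \prod_(j < N | j != i)
    (setc Q i b 0 j ^+ x j * (1 - setc Q i b 0 j) ^+ (~~ x j)) =
    \prod_(j < N | j != i) (Q 0 j ^+ x j * (1 - Q 0 j) ^+ (~~ x j)).
  by apply: eq_bigr => j ji; rewrite setc_neq.
rewrite !rest; set p := \prod_(_ < N | _) _.
by case: (x i) => /=; rewrite ?expr1 ?expr0; ring.
Qed.

(** The closed cube is the right domain because [dOmega] evaluates [Omega] on the faces where a
    coordinate is 0 or 1. *)
Definition closed_cube : set 'rV[R]_N := [set Q | forall i, 0 <= Q 0 i <= 1].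

Lemma cube_closed Q : cube Q -> closed_cube Q.
Proof. by move=> cQ i; have /andP[a b] := cQ i; rewrite !ltW. Qed.

Lemma closed_cube_setc Q i q : closed_cube Q -> 0 <= q <= 1 ->
  closed_cube (setc Q i q).
Proof. by move=> cQ q01 j; rewrite mxE; case: eqP. Qed.

(** A Lipschitz constant of [Omega] for the sup norm: each of the N factors of a product moves by at
    most [|x - y|]. *)
Definition lipOmega Psi : R :=
  (\sum_(z : {ffun 'I_N -> bool}) `|Psi z|) * N%:R.

Lemma lipOmega_ge0 Psi : 0 <= lipOmega Psi.
Proof. by rewrite mulr_ge0// sumr_ge0. Qed.

Lemma Omega_lipschitz Psi x y : closed_cube x -> closed_cube y ->
  `|Omega Psi x - Omega Psi y| <= lipOmega Psi * `|x - y|.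
Proof.
move=> cx cy; rewrite /Omega -sumrB (le_trans (ler_norm_sum _ _ _))//.
rewrite /lipOmega -mulrA mulr_suml; apply: ler_sum => z _.
rewrite -mulrBr normrM ler_wpM2l//.
have b1 w : closed_cube w -> forall i, `|w 0 i ^+ z i * (1 - w 0 i) ^+ (~~ z i)| <= 1.
  move=> cw i; have := cw i; case: (z i) => /=; rewrite expr0 expr1 => wi;
    rewrite ?mulr1 ?mul1r ler_norml; lra.
rewrite (le_trans (norm_prod_diff_le _ (b1 x cx) (b1 y cy)))//.
rewrite mulr_natl -[N in _ *+ N]card_ord -sumr_const.
apply: ler_sum => i _; apply: le_trans (normr_coord (x - y) i); rewrite !mxE.
case: (z i) => /=; rewrite !expr0 !expr1 ?mulr1 ?mul1r//.
by rewrite (_ : 1 - x 0 i - (1 - y 0 i) = - (x 0 i - y 0 i)) ?normrN//; ring.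
Qed.

Lemma dOmega_lipschitz Psi i x y : closed_cube x -> closed_cube y ->
  `|dOmega Psi i x - dOmega Psi i y| <= 2 * lipOmega Psi * `|x - y|.
Proof.
move=> cx cy.
have L b : 0 <= b <= 1 -> `|Omega Psi (setc x i b) - Omega Psi (setc y i b)|
    <= lipOmega Psi * `|x - y|.
  move=> b01; apply: (le_trans (Omega_lipschitz _ _ _)); rewrite ?lipOmega_ge0//;
    try exact: closed_cube_setc.
  rewrite ler_wpM2l ?lipOmega_ge0//; apply: normr_row_le => // j.
  rewrite !mxE; case: eqP => [_|_]; first by rewrite subrr normr0.
  by have := normr_coord (x - y) j; rewrite !mxE.
have L1 := L 1 _; have L0 := L 0 _.
rewrite /dOmega.
rewrite (_ : _ - _ - (_ - _) = (Omega Psi (setc x i 1) - Omega Psi (setc y i 1))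
  - (Omega Psi (setc x i 0) - Omega Psi (setc y i 0))); last by ring.
rewrite (le_trans (ler_normB _ _))// -mulrA mulr_natl mulr2n.
by apply: lerD; [apply: L1|apply: L0]; rewrite ?lexx ?ler01.
Qed.

Lemma differentiable_Omega Psi Q : differentiable (Omega Psi) Q.
Proof.
apply: differentiable_bigop_sum => z.
apply: differentiableM; first exact: differentiable_cst.
apply: differentiable_bigop_prod => i.
have dc : differentiable (fun P : 'rV[R]_N => P 0 i : R) Q.
  exact: differentiable_coord.
by apply: differentiableM; case: (z i) => /=;
  do ?[exact: dc|exact: differentiable_cst|exact: differentiableB].
Qed.

Lemma differentiable_setc i q Q : differentiable (fun P => setc P i q) Q.
Proof.
have -> : (fun P => setc P i q) =
    (fun P : 'rV[R]_N => P + (q - P 0 i) *: (delta_mx 0 i : 'rV[R]_N)).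
  apply/funext => P; apply/rowP => j; rewrite !mxE eqxx/=.
  by case: eqP => [->|_]; rewrite ?mulr1 ?mulr0 ?addr0 ?subrKC.
apply: differentiableD => //; apply: differentiableZl.
by apply: differentiableB => //; exact: differentiable_coord.
Qed.

Lemma differentiable_dOmega Psi i Q : differentiable (dOmega Psi i) Q.
Proof.
by apply: differentiableB;
  apply: (@differentiable_comp _ _ _ _ (fun P => setc P i _) (Omega Psi));
  [exact: differentiable_setc|exact: differentiable_Omega
  |exact: differentiable_setc|exact: differentiable_Omega].
Qed.

Lemma G_setc Psi p Q i q : G Psi p (setc Q i q) =
  q * dOmega Psi i Q + bernoulli_kl q (p 0 i) +
  (Omega Psi (setc Q i 0) + \sum_(j < N | j != i) bernoulli_kl (Q 0 j) (p 0 j)).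
Proof.
rewrite /G Omega_setc (bigD1 i)//= setc_at.
rewrite (eq_bigr (fun j => bernoulli_kl (Q 0 j) (p 0 j))); first by ring.
by move=> j ji; rewrite setc_neq.
Qed.

Lemma is_derive_G_setc Psi p Q i q : cube p -> 0 < q < 1 ->
  is_derive q (1 : R) (fun q => G Psi p (setc Q i q))
    (dOmega Psi i Q + (logit q - logit (p 0 i))).
Proof.
move=> cp q01; rewrite (funext (G_setc Psi p Q i)).
have d1 := is_derive_bernoulli_kl q01 (cp i).
apply: is_derive_eq; rewrite /GRing.scale/=; ring.
Qed.

Lemma partial_G Psi p Q i : cube p -> cube Q ->
  partial (G Psi p) i Q = dOmega Psi i Q + (logit (Q 0 i) - logit (p 0 i)).
Proof.
move=> cp cQ; have := is_derive_G_setc Psi Q i cp (cQ i).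
under [X in is_derive _ _ X _]eq_fun do rewrite setc_line.
move=> /is_derive_line; rewrite -setc_line setc_id => d.
by rewrite /partial derive_val.
Qed.

Lemma open_cube Q : cube Q -> \forall P \near Q, cube P.
Proof.
move=> cQ.
suff cQi i : \forall P \near nbhs Q, 0 < (P : 'rV[R]_N) 0 i < 1 by exact: filter_forall cQi.
have /andP[Q0 Q1] := cQ i.
have cv : (fun P : 'rV[R]_N => P 0 i) P @[P --> Q] --> Q 0 i.
  exact: coord_continuous.
near=> P; apply/andP; split; near: P.
  exact: (cvgr_gt _ cv).
exact: (cvgr_lt _ cv).
Unshelve. all: by end_near. Qed.

Lemma derivable_logit q : 0 < q < 1 -> derivable (@logit R) q 1.
Proof.
move=> /andP[q0 q1].
have d1 : derivable (@ln R) q 1 by apply: ex_derive; exact: is_derive1_ln.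
apply: derivableB => //; apply/derivable1_diffP.
apply: (@differentiable_comp _ _ _ _ (fun q : R => 1 - q) (@ln R)) => //.
apply/derivable1_diffP; apply: ex_derive; apply: is_derive1_ln.
by rewrite subr_gt0.
Qed.

Lemma differentiable_G Psi p Q : cube p -> cube Q -> differentiable (G Psi p) Q.
Proof.
move=> cp cQ; apply: differentiableD; first exact: differentiable_Omega.
apply: differentiable_bigop_sum => i.
apply: (@differentiable_comp _ _ _ _ (fun P : 'rV[R]_N => P 0 i : R)
  (fun q => bernoulli_kl q (p 0 i))); first exact: differentiable_coord.
apply/derivable1_diffP; have d := is_derive_bernoulli_kl (cQ i) (cp i).
exact: ex_derive.
Qed.

End MeanFieldCalculus.

(** * Proximal steps *)

Section ProximalSteps.
Context {R : realType} {N : nat}.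
Variables (Psi : {ffun 'I_N -> bool} -> R) (p : 'rV[R]_N) (lambda : R).
Variable (Q : nat -> 'rV[R]_N).
Hypotheses (cp : cube p) (lambda0 : 0 < lambda).
Hypothesis prox : proximal_sequence Psi p lambda Q.

Lemma proximal_cube t : cube (Q t).
Proof.
case: prox => Q0 Qs; case: t => [|t] i; first by rewrite Q0.
by have [] := Qs t i; rewrite /= in_itv.
Qed.

(** The minimizer lies in the open interval, so the derivative of the one-variable objective
    vanishes there. [dOmega] is taken at the partially updated point, not at [Q t.+1]. *)
Lemma proximal_first_order t i :
  dOmega Psi i (splice (Q t.+1) (Q t) i (Q t.+1 0 i)) +
  (logit (Q t.+1 0 i) - logit (p 0 i)) +
  lambda * (logit (Q t.+1 0 i) - logit (Q t 0 i)) = 0.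
Proof.
have [_ /(_ t i) [_ qmin]] := prox.
pose S := splice (Q t.+1) (Q t) i (Q t.+1 0 i).
pose h (q : R) := G Psi p (setc S i q) + lambda * bernoulli_kl q (Q t 0 i).
have dh (q : R) : 0 < q < 1 -> is_derive q (1 : R) h
    (dOmega Psi i S + (logit q - logit (p 0 i)) +
     lambda * (logit q - logit (Q t 0 i))).
  move=> q01; have d1 := is_derive_G_setc Psi S i cp q01.
  have d2 := is_derive_bernoulli_kl q01 (proximal_cube t i).
  by apply: is_derive_eq; rewrite /GRing.scale/=; ring.
have q01 := proximal_cube t.+1 i.
have dh0 : is_derive (Q t.+1 0 i) (1 : R) h 0.
  apply: (@derive1_at_min R h 0 1) => //.
  - by move=> q; rewrite in_itv/= => /dh dq; exact: ex_derive.
  - by move=> q qI; rewrite /h !setc_splice; apply: qmin.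
by rewrite -(derive_val (is_derive := dh _ q01)) (derive_val (is_derive := dh0)).
Qed.

Lemma proximal_decrease t :
  lambda / 4 * `|Q t.+1 - Q t| ^+ 2 <= G Psi p (Q t) - G Psi p (Q t.+1).
Proof.
have [_ /(_ t) qmin] := prox.
set P := Q t.+1 in qmin *; set P0 := Q t in qmin *.
(* The sweep is cut into its intermediate points: stages k and k+1 differ only in the coordinate of
   index k, and the decreases add up over the stages. *)
pose stage k : 'rV[R]_N := \row_j (if (j < k)%N then P 0 j else P0 0 j).
have stepP k : (k <= N)%N -> G Psi p (stage k) +
    lambda / 4 * \sum_(j < N | (j < k)%N) (P 0 j - P0 0 j) ^+ 2 <= G Psi p P0.
  elim: k => [_|k IH kN].
    rewrite big_pred0// mulr0 addr0 (_ : stage 0%N = P0)//.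
    by apply/rowP => j; rewrite !mxE.
  pose i := Ordinal kN; apply: le_trans (IH (ltnW kN)).
  have s1 : stage k.+1 = splice P P0 i (P 0 i).
    apply/rowP => j; rewrite !mxE ltnS leq_eqVlt -(inj_eq val_inj) /=.
    by case: (ltngtP j k) => //= jk; rewrite (_ : j = i)//; exact: val_inj.
  have s0 : stage k = splice P P0 i (P0 0 i).
    apply/rowP => j; rewrite !mxE -(inj_eq val_inj) /=.
    by case: (ltngtP j k) => //= jk; rewrite (_ : j = i)//; exact: val_inj.
  rewrite (bigD1 i)//= (eq_bigl (fun j : 'I_N => (j < k)%N)); last first.
    move=> j; rewrite ltnS leq_eqVlt -(inj_eq val_inj) /=.
    by case: (ltngtP j k).
  rewrite mulrDr addrA lerD2r s1 s0.
  have c0 : cube P0 by exact: proximal_cube.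
  have c1 : cube P by exact: proximal_cube.
  (* The competitor is the old coordinate, where the proximal term vanishes. *)
  have [_ /(_ (P0 0 i))] := qmin i.
  rewrite /= in_itv/= => /(_ (c0 i)); rewrite bernoulli_kl_self// mulr0 addr0.
  apply: le_trans; rewrite lerD2l -mulrA ler_wpM2l ?(ltW lambda0)//.
  by rewrite mulrC bernoulli_kl_ge.
have := stepP N (leqnn N); rewrite (_ : stage N = P); last first.
  by apply/rowP => j; rewrite !mxE ltn_ord.
rewrite (eq_bigl xpredT) => [H|j]; last by rewrite ltn_ord.
rewrite lerBrDl; apply: le_trans H; rewrite lerD2l ler_wpM2l//.
  by rewrite divr_ge0// ltW.
have : `|P - P0| ^+ 2 <= norm2 (P - P0) ^+ 2.
  by rewrite lerXn2r ?nnegrE ?norm2_ge0 ?normr_le_norm2.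
rewrite /norm2 sqr_sqrtr ?sum_sqr_ge0// => /le_trans; apply.
by apply: ler_sum => j _; rewrite !mxE.
Qed.

Lemma proximal_grad_le (delta : R) t : 0 < delta ->
  (forall i, delta <= Q t 0 i <= 1 - delta) ->
  (forall i, delta <= Q t.+1 0 i <= 1 - delta) ->
  norm2 (grad (G Psi p) (Q t.+1)) <=
    Num.sqrt N%:R * (2 * lipOmega Psi + lambda * (2 / delta)) * `|Q t.+1 - Q t|.
Proof.
move=> d0 dt dt1; rewrite (le_trans (norm2_le _))// -mulrA.
rewrite ler_wpM2l ?sqrtr_ge0//.
have K0 : 0 <= 2 * lipOmega Psi + lambda * (2 / delta).
  by apply: addr_ge0; apply: mulr_ge0;
    rewrite ?lipOmega_ge0 ?divr_ge0 ?(ltW lambda0) ?(ltW d0).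
apply: normr_row_le => [|i]; first by rewrite mulr_ge0.
rewrite mxE partial_G//; last exact: proximal_cube.
have fo := proximal_first_order t i.
set S := splice _ _ _ _ in fo.
(* Subtracting the first-order condition leaves the change of [dOmega] over the coordinates not yet
   updated and the proximal term; both are of the order of the step. *)
have -> : dOmega Psi i (Q t.+1) + (logit (Q t.+1 0 i) - logit (p 0 i)) =
  (dOmega Psi i (Q t.+1) - dOmega Psi i S) -
    lambda * (logit (Q t.+1 0 i) - logit (Q t 0 i)) by lra.
rewrite (le_trans (ler_normB _ _))// mulrDl lerD//.
  apply: (le_trans (dOmega_lipschitz _ _ _ _)).
  - exact/cube_closed/proximal_cube.
  - move=> j; rewrite mxE.
    case: ifP => _; first exact/cube_closed/proximal_cube.
    case: ifP => _; exact/cube_closed/proximal_cube.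
  have L0 : 0 <= 2 * lipOmega Psi by apply: mulr_ge0 => //; exact: lipOmega_ge0.
  rewrite ler_wpM2l//.
  apply: normr_row_le => // j; rewrite !mxE.
  case: ifP => _; first by rewrite subrr normr0.
  case: eqP => [->|_]; first by rewrite subrr normr0.
  by have := normr_coord (Q t.+1 - Q t) j; rewrite !mxE.
rewrite normrM (gtr0_norm lambda0) -mulrA ler_wpM2l ?(ltW lambda0)//.
apply: (le_trans (logit_lipschitz d0 (dt1 i) (dt i))).
rewrite ler_wpM2l ?divr_ge0 ?(ltW d0)//.
by have := normr_coord (Q t.+1 - Q t) i; rewrite !mxE.
Qed.

End ProximalSteps.

(** * Nondegenerate critical points have exponent 1/2 *)

Section PowerDesingularizing.
Context {R : realType}.

Lemma derive1_scale_powR (c a s : R) : 0 < s ->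
  derive1 (fun s => c * s `^ a) s = c * a * s `^ (a - 1).
Proof.
move=> s0; have d := is_derive1_powR a s0.
have dc : is_derive s (1 : R) (fun s => c * s `^ a) (c *: (a * s `^ (a - 1))).
  exact: is_deriveZ.
by rewrite derive1E derive_val /GRing.scale/= mulrA.
Qed.

(** After squaring, the difference of the two sides is t(1-t)(sqrt a - sqrt b)^2. *)
Lemma concave_sqrt (t a b : R) : 0 <= t <= 1 -> 0 <= a -> 0 <= b ->
  t * Num.sqrt a + (1 - t) * Num.sqrt b <= Num.sqrt (t * a + (1 - t) * b).
Proof.
move=> /andP[t0 t1] a0 b0; have t1' : 0 <= 1 - t by rewrite subr_ge0.
rewrite -(@ler_pXn2r _ 2)// ?nnegrE ?addr_ge0 ?mulr_ge0 ?sqrtr_ge0//.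
rewrite sqr_sqrtr ?addr_ge0 ?mulr_ge0//.
rewrite -[in leRHS](sqr_sqrtr a0) -[in leRHS](sqr_sqrtr b0).
rewrite -subr_ge0 [leRHS](_ : _ = t * (1 - t) * (Num.sqrt a - Num.sqrt b) ^+ 2).
  by rewrite mulr_ge0 ?sqr_ge0// mulr_ge0.
by ring.
Qed.

(** Needed to establish exponent 1/2 from the Hessian; elsewhere this property is part of the
    assumed [KL_exponent]. *)
Lemma desingularizing_sqrt (c eta : R) : 0 < c ->
  desingularizing eta (fun s => c * s `^ (1 - 1 / 2)).
Proof.
move=> c0; have e : 1 - 1 / 2 = 2^-1 :> R by lra.
have sq (s : R) : 0 <= s -> s `^ (1 - 1 / 2) = Num.sqrt s by rewrite e; exact: powR12_sqrt.
split.
- by move=> s _; rewrite mulr_ge0 ?powR_ge0 ?ltW.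
(* Continuity of [Num.sqrt] on the whole line takes care of the endpoint 0. *)
- apply: (@subspace_eq_continuous _ _ _ (fun s => c * Num.sqrt s)).
    move=> s; rewrite inE/= in_itv/= => /andP[s0 _].
    exact: (congr1 ( *%R c) (esym (sq s s0))).
  apply: continuous_subspaceT => s.
  by apply: cvgM; [exact: cvg_cst|exact: sqrt_continuous].
- move=> t s s'; rewrite !inE/= !in_itv/= => /andP[s0 _] /andP[s'0 _].
  have t01 : 0 <= t%:num <= 1 by apply/andP; split.
  have conv_ge0 : 0 <= t%:num * s + (1 - t%:num) * s'.
    by rewrite addr_ge0 ?mulr_ge0// subr_ge0; case/andP: t01.
  rewrite (_ : conv t s s' = t%:num * s + (1 - t%:num) * s')// !convRE/= !sq//.
  have := ler_wpM2l (ltW c0) (concave_sqrt t01 s0 s'0).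
  rewrite /unstable.onem; lra.
- by rewrite e powR0 ?mulr0.
move=> s /andP[s0 _]; have d := is_derive1_powR (1 - 1 / 2 : R) s0.
split.
- apply: derivableM => //; exact: derivable_cst.
- have E : {near s, (fun s => c * (1 - 1 / 2) * s `^ (1 - 1 / 2 - 1)) =1
      derive1 (fun s : R => c * s `^ (1 - 1 / 2))}.
    by near=> z; rewrite derive1_scale_powR//; near: z; exact: lt_nbhsr.
  have d' := is_derive1_powR (1 - 1 / 2 - 1 : R) s0.
  have cv : c * (1 - 1 / 2) * z `^ (1 - 1 / 2 - 1) @[z --> s] -->
      derive1 (fun s : R => c * s `^ (1 - 1 / 2)) s.
    rewrite derive1_scale_powR//; apply: cvgM; first exact: cvg_cst.
    apply: (@differentiable_continuous _ _ _ _ (fun s : R => s `^ _)).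
    by apply/derivable1_diffP; exact: ex_derive.
  exact: cvg_trans (near_eq_cvg E) cv.
- by rewrite derive1_scale_powR// !mulr_gt0 ?powR_gt0//; lra.
Unshelve. all: by end_near. Qed.

End PowerDesingularizing.

Section NondegenerateKL.
Context {R : realType} {n : nat}.
Implicit Types (f : 'rV[R]_n -> R) (D : set 'rV[R]_n) (x v : 'rV[R]_n).

Lemma differentiable_near_le f x (e : R) : 0 < e -> differentiable f x ->
  \forall v \near (0 : 'rV[R]_n), `|f (v + x) - f x - 'd f x v| <= e * `|v|.
Proof.
move=> e0 /diff_locally/eqaddoP/(_ e e0); apply: filterS => v.
by rewrite /= opprD addrA.
Qed.

Lemma normr_mulmx_le (m k : nat) (w : 'rV[R]_m) (A : 'M[R]_(m, k)) :
  `|w *m A| <= (\sum_i \sum_j `|A i j|) * `|w|.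
Proof.
apply: normr_row_le => [|j].
  by rewrite mulr_ge0// sumr_ge0// => i _; rewrite sumr_ge0.
rewrite mxE (le_trans (ler_norm_sum _ _ _))// mulr_suml; apply: ler_sum => i _.
rewrite normrM mulrC; apply: ler_pM => //; last exact: normr_coord.
by rewrite (bigD1 j)//= lerDl sumr_ge0.
Qed.

Lemma posdef_unitmx (A : 'M[R]_n) : posdef A -> A \in unitmx.
Proof.
move=> pA; rewrite -row_free_unit; apply: inj_row_free => v vA.
apply/eqP/negPn/negP => /pA; rewrite vA mul0mx mxE ltxx//.
Qed.

(* The gradient is g; it is only assumed to be differentiable at x itself, so
   that no second-order Taylor formula is needed: an invertible Hessian gives
   |v| <= C |grad f (x + v)|, and the mean value theorem gives
   f (x + v) - f x <= C' |v|^2. *)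
Lemma KL_half_of_nondegenerate D f x (g : 'I_n -> 'rV[R]_n -> R) :
  (\forall y \near x, D y) -> (forall y, D y -> differentiable f y) ->
  (forall y, D y -> forall i, partial f i y = g i y) ->
  (forall i, differentiable (g i) x) ->
  grad f x = 0 -> hessian f x \in unitmx ->
  KL_exponent D f x (1 / 2).
Proof.
move=> nD df fg dg gx0 unitH; set H := hessian f x in unitH.
have Dx : D x := nbhs_singleton nD.
have dgE i v : 'd (g i) x v = (v *m H) 0 i.
  rewrite diff_partial// mxE; apply: eq_bigr => j _; rewrite mxE; congr (_ * _).
  apply: near_eq_derive; apply: filterS nD => y Dy; exact/esym/fg.
have gx i : g i x = 0.
  by rewrite -fg//; move/rowP: gx0 => /(_ i); rewrite !mxE.
pose K : R := \sum_i \sum_j `|invmx H i j| + 1.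
pose M : R := \sum_i \sum_j `|H i j|.
have sum0 (A : 'M[R]_n) : 0 <= \sum_i \sum_j `|A i j|.
  by rewrite sumr_ge0// => i _; rewrite sumr_ge0.
have K0 : 0 < K by rewrite ltr_wpDl.
have M0 : 0 <= M by exact: sum0.
have HK v : `|v| <= K * `|v *m H|.
  rewrite -{1}(mulmxK unitH v) (le_trans (normr_mulmx_le _ _))//.
  by rewrite ler_wpM2r// lerDl.
(* With this choice the linearization error K e |v| equals |v|/2 and is absorbed by the left-hand
   side in [lower]. *)
pose e := (2 * K)^-1.
have e0 : 0 < e by rewrite invr_gt0 mulr_gt0.
have near0 : \forall v \near (0 : 'rV[R]_n),
    D (v + x) /\ forall i, `|g i (v + x) - (v *m H) 0 i| <= e * `|v|.
  have nD0 : \forall v \near (0 : 'rV[R]_n), D (v + x).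
    by rewrite (near_shift 0) in nD; apply: filterS nD => v; rewrite /= subr0.
  have ng i : \forall v \near (0 : 'rV[R]_n),
      `|g i (v + x) - (v *m H) 0 i| <= e * `|v|.
    apply: filterS (differentiable_near_le e0 (dg i)) => v.
    by rewrite gx subr0 dgE.
  have ng' : \forall v \near (0 : 'rV[R]_n),
      forall i, `|g i (v + x) - (v *m H) 0 i| <= e * `|v|.
    exact: filter_forall ng.
  exact: filterI nD0 ng'.
have {near0} [rho rho0 near0] : exists2 rho : R, 0 < rho & forall v, `|v| < rho ->
    D (v + x) /\ forall i, `|g i (v + x) - (v *m H) 0 i| <= e * `|v|.
  move/nbhs_ballP: near0 => [rho rho0 sub]; exists rho => // v vr.
  by apply: sub; rewrite -ball_normE /= sub0r normrN.
have lower v : `|v| < rho -> `|v| <= 2 * K * norm2 (grad f (v + x)).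
  move=> /near0 [Dv gv].
  have : `|v *m H| <= norm2 (grad f (v + x)) + e * `|v|.
    apply: normr_row_le => [|i]; first by rewrite addr_ge0 ?norm2_ge0// mulr_ge0// ltW.
    have := norm2_coord (grad f (v + x)) i; rewrite mxE fg// => gi.
    have -> : (v *m H) 0 i = g i (v + x) - (g i (v + x) - (v *m H) 0 i).
      by rewrite subKr.
    by rewrite (le_trans (ler_normB _ _))// lerD.
  move=> /(ler_wpM2l (ltW K0)); rewrite mulrDr => vH.
  have := le_trans (HK v) vH.
  have -> : K * (e * `|v|) = `|v| / 2 by rewrite /e; field; rewrite gt_eqF.
  lra.
(* Since the gradient vanishes at x, each partial derivative on the segment is at most (M + e)|v|;
   the mean value theorem then sums n such terms, each times |v|. *)
pose L := n%:R * (M + e).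
have L0 : 0 <= L by rewrite mulr_ge0// addr_ge0// ltW.
have upper v : `|v| < rho -> f (v + x) - f x <= L * `|v| ^+ 2.
  move=> vr; pose h (s : R) := f (s *: v + x).
  have sv (s : R) : 0 <= s <= 1 -> `|s *: v| <= `|v|.
    by move=> /andP[s0 s1]; rewrite normrZ ger0_norm// ler_piMl.
  have dh (s : R) : 0 <= s <= 1 -> is_derive s (1 : R) h ('d f (s *: v + x) v).
    move=> s01; apply/is_derive_line.
    have [Dv _] := near0 _ (le_lt_trans (sv _ s01) vr).
    have dfv := df _ Dv.
    by apply: DeriveDef; [exact: diff_derivable|rewrite deriveE].
  have [||s] := @MVT_segment R h (fun s => 'd f (s *: v + x) v) 0 1 ler01.
  - by move=> s /itvP s01; apply: dh; rewrite !ltW ?s01.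
  - apply: derivable_within_continuous => s; rewrite in_itv/= => /dh ds.
    exact: ex_derive.
  rewrite in_itv/= => s01; rewrite /h scale1r scale0r add0r subr0 mulr1 => ->.
  have svr := le_lt_trans (sv _ s01) vr.
  have [Dv gv] := near0 _ svr.
  rewrite diff_partial; last exact: df.
  apply: (@le_trans _ _ (\sum_(i < n) `|v| * ((M + e) * `|v|))).
    apply: ler_sum => i _; rewrite fg//.
    rewrite (le_trans (ler_norm _))// normrM ler_pM ?normr_coord//.
    have -> : g i (s *: v + x) = (g i (s *: v + x) - ((s *: v) *m H) 0 i) +
       ((s *: v) *m H) 0 i by rewrite subrK.
    rewrite (le_trans (ler_normD _ _))// addrC mulrDl lerD//.
      rewrite (le_trans (normr_coord _ _))// (le_trans (normr_mulmx_le _ _))//.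
      by rewrite ler_wpM2l// sv.
    by rewrite (le_trans (gv i))// ler_wpM2l ?(ltW e0)// sv.
  rewrite sumr_const card_ord /L -[leLHS]mulr_natl.
  by rewrite [leLHS](_ : _ = n%:R * (M + e) * `|v| ^+ 2)//; ring.
(* Combining [upper] and [lower] gives sqrt s <= sqrt L * 2K * |grad f|. The factor 2 in the witness
   [2 * B] cancels the 1/2 from differentiating the square root. *)
pose B := Num.sqrt L * (2 * K) + 1.
have B0 : 0 < B by rewrite ltr_wpDl// !mulr_ge0 ?sqrtr_ge0// ltW.
exists (2 * B); first by rewrite mulr_gt0.
split; [exact: Dx|exact: df|exists 1; first exact: ltr01].
split; first by apply: desingularizing_sqrt; rewrite mulr_gt0.
have nrho : \forall y \near x, `|y - x| < rho.
  by apply/nbhs_ballP; exists rho => //= y; rewrite -ball_normE/= distrC.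
apply: filterS nrho => y yr _ /andP[fxy _].
have s0 : 0 < f y - f x by rewrite subr_gt0.
have := lower _ yr; have := upper _ yr; rewrite subrK.
set s := f y - f x in s0 *; set w := `|y - x|; set gr := norm2 _ => up low.
rewrite derive1_scale_powR//.
rewrite (_ : 1 - 1 / 2 - 1 = - 2^-1) ?powRN ?powR12_sqrt ?(ltW s0)//; last by lra.
have ss0 : 0 < Num.sqrt s by rewrite sqrtr_gt0.
have : Num.sqrt s <= B * gr.
  apply: (@le_trans _ _ (Num.sqrt L * w)).
    rewrite -(@ler_pXn2r _ 2)// ?nnegrE ?mulr_ge0 ?sqrtr_ge0 ?normr_ge0//.
    by rewrite exprMn !sqr_sqrtr// ltW.
  rewrite (le_trans (ler_wpM2l (sqrtr_ge0 L) low))// mulrA ler_wpM2r ?norm2_ge0//.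
  by rewrite lerDl.
move=> sB; rewrite (_ : _ * _ = (Num.sqrt s)^-1 * (B * gr)); last by field; rewrite gt_eqF.
by rewrite ler_pdivlMl// mulr1.
Qed.

End NondegenerateKL.

(** * Convergence of the proximal procedure *)

Section ProximalConvergence.
Context {R : realType} {N : nat}.
Variables (Psi : {ffun 'I_N -> bool} -> R) (p : 'rV[R]_N) (lambda : R).
Variables (Q : nat -> 'rV[R]_N) (Qb : 'rV[R]_N).
Hypotheses (cp : cube p) (lambda0 : 0 < lambda).
Hypothesis prox : proximal_sequence Psi p lambda Q.
Hypothesis QQb : Q @ \oo --> Qb.
Hypothesis cQb : cube Qb.

Let r t := G Psi p (Q t) - G Psi p Qb.

Let r_decrease t : lambda / 4 * `|Q t.+1 - Q t| ^+ 2 <= r t - r t.+1.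
Proof.
have := proximal_decrease cp lambda0 prox t.
by rewrite /r opprB addrA subrK.
Qed.

Let r_noninc t : r t.+1 <= r t.
Proof.
rewrite -subr_ge0 (le_trans _ (r_decrease t))// mulr_ge0 ?exprn_ge0//.
by rewrite divr_ge0// ltW.
Qed.

Let r_noninc_le s t : (s <= t)%N -> r t <= r s.
Proof.
move=> st; rewrite -(subnK st); elim: (t - s)%N => // k; apply: le_trans.
exact: r_noninc.
Qed.

Let r_cvg0 : r @ \oo --> (0 : R).
Proof.
rewrite -(subrr (G Psi p Qb)); apply: cvgB; last exact: cvg_cst.
apply: continuous_cvg QQb.
exact/differentiable_continuous/differentiable_G.
Qed.

Let r_ge0 t : 0 <= r t.
Proof.
rewrite -(cvg_lim _ r_cvg0)//; apply: limr_le.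
  by apply/cvg_ex; exists 0; exact: r_cvg0.
by exists t => // s /= /r_noninc_le.
Qed.

(** Once the gap is 0 it stays 0, so sufficient decrease makes all later steps vanish and the
    constant value must be the limit. *)
Let stationary T : r T = 0 -> forall t, (T <= t)%N -> Q t = Qb.
Proof.
move=> rT; have rt0 t : (T <= t)%N -> r t = 0.
  by move=> /r_noninc_le; rewrite rT => rt; apply/eqP; rewrite eq_le rt r_ge0.
have QS t : (T <= t)%N -> Q t.+1 = Q t.
  move=> Tt; apply/eqP; rewrite -subr_eq0 -normr_eq0 -sqrf_eq0 eq_le sqr_ge0 andbT.
  have := r_decrease t; rewrite rt0// rt0 ?(leqW Tt)// subrr pmulr_rle0//.
  by rewrite divr_gt0.
have QT t : (T <= t)%N -> Q t = Q T.
  move=> Tt; rewrite -(subnK Tt); elim: (t - T)%N => // k IH.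
  by rewrite addSn QS ?IH// leq_addl.
suff <- : Q T = Qb by exact: QT.
apply: cvg_unique QQb => //; apply: cvg_near_cst.
by exists T => // t /= /QT.
Qed.

(** The limit is interior and there are finitely many coordinates, so a single margin serves all of
    them eventually. *)
Let coords_away : exists2 delta : R, 0 < delta &
  \forall t \near \oo, forall i, delta <= Q t 0 i <= 1 - delta.
Proof.
have [delta d0 dQ] : exists2 delta : R, 0 < delta &
    forall i, delta < Qb 0 i < 1 - delta.
  have nd i : \forall e \near (0 : R)^'+, e < Qb 0 i < 1 - e.
    have /andP[q0 q1] := cQb i.
    near=> e; rewrite ltrBrDl -ltrBrDr; apply/andP; split; near: e;
      by apply: nbhs_right_lt; rewrite ?subr_gt0.
  have nd' : \forall e \near (0 : R)^'+, 0 < e /\ forall i, e < Qb 0 i < 1 - e.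
    apply: filterI; first exact: nbhs_right_gt.
    exact: filter_forall nd.
  by have [e [e0 eQ]] := filter_ex nd'; exists e.
exists delta => //; apply: filter_forall => i.
have cv : Q t 0 i @[t --> \oo] --> Qb 0 i.
  exact: (cvg_comp Q (fun P : 'rV[R]_N => P 0 i) QQb (@coord_continuous _ _ _ 0 i Qb)).
have /andP[q0 q1] := dQ i.
near=> t; apply/andP; split; near: t.
- exact: (cvgr_ge _ cv).
- exact: (cvgr_le _ cv).
Unshelve. all: by end_near. Qed.

Let KL_recurrence theta : 0 < theta < 1 ->
  KL_exponent cube (G Psi p) Qb theta -> (forall t, 0 < r t) ->
  exists2 b : R, 0 < b & \forall t \near \oo,
    r t <= 1 /\ r t.+1 `^ theta <= b * `|Q t.+1 - Q t|.
Proof.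
move=> /andP[th0 th1] [c c0 [_ _ [eta eta0 [_ KL]]]] r0.
have [delta d0 away] := coords_away.
pose K := Num.sqrt N%:R * (2 * lipOmega Psi + lambda * (2 / delta)).
have K0 : 0 <= K.
  apply: mulr_ge0; first exact: sqrtr_ge0.
  by apply: addr_ge0; apply: mulr_ge0;
    rewrite ?lipOmega_ge0 ?divr_ge0 ?(ltW lambda0) ?(ltW d0).
have ct0 : 0 < c * (1 - theta) by rewrite mulr_gt0// subr_gt0.
exists (c * (1 - theta) * (K + 1)); first by rewrite mulr_gt0// ltr_wpDl.
(* The inequality is used at the new iterate, where the gradient bound holds; eventual properties
   are therefore shifted by one index. *)
have S (P : nat -> Prop) : (\forall t \near \oo, P t) -> \forall t \near \oo, P t.+1.
  by move=> [T _ TP]; exists T => // t /= Tt; apply: TP; exact: leqW.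
have KLnext := S _ (QQb KL).
have eta_next := S _ (cvgr_lt _ r_cvg0 _ eta0).
have away_next := S _ away.
near=> t; split.
  by near: t; exact: (cvgr_le _ r_cvg0 _ ltr01).
have KLt : 1 <= derive1 (fun s => c * s `^ (1 - theta)) (r t.+1) *
    norm2 (grad (G Psi p) (Q t.+1)).
  have KLt : cube (Q t.+1) -> G Psi p Qb < G Psi p (Q t.+1) < G Psi p Qb + eta ->
    1 <= derive1 (fun s => c * s `^ (1 - theta)) (r t.+1) *
      norm2 (grad (G Psi p) (Q t.+1)).
    by near: t; exact: KLnext.
  apply: KLt; first exact: (proximal_cube cp prox).
  rewrite -subr_gt0 -/(r t.+1) r0/= -ltrBlDl -/(r t.+1).
  by near: t; exact: eta_next.
have gradt : norm2 (grad (G Psi p) (Q t.+1)) <= K * `|Q t.+1 - Q t|.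
  apply: (proximal_grad_le cp lambda0 prox d0); near: t => //.
rewrite derive1_scale_powR// (_ : 1 - theta - 1 = - theta) in KLt; last by lra.
rewrite powRN mulrAC ler_pdivlMr ?powR_gt0// mul1r in KLt.
rewrite (le_trans KLt)// -mulrA ler_wpM2l ?(ltW ct0)// (le_trans gradt)//.
by rewrite ler_wpM2r// lerDl.
Unshelve. all: by end_near. Qed.

Let stationary_rate (rate : nat -> R) : (exists t, r t = 0) ->
  \forall t \near \oo, norm2 (Q t - Qb) <= 0 * rate t.
Proof.
move=> [T rT]; exists T => // t /= Tt; rewrite (stationary rT Tt) subrr mul0r.
by rewrite (le_trans (norm2_le _))// normr0 mulr0.
Qed.

(** The Kurdyka-Lojasiewicz inequality speaks only of values strictly above the limit value; the
    stationary case is treated apart. *)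
Let dichotomy : (exists t, r t = 0) \/ forall t, 0 < r t.
Proof.
have [?|/forallNP rn0] := pselect (exists t, r t = 0); [by left|right=> t].
by rewrite lt_neqAle r_ge0 andbT eq_sym; apply/eqP.
Qed.

Lemma proximal_linear_rate theta : 0 < theta <= 1 / 2 ->
  KL_exponent cube (G Psi p) Qb theta -> linear_rate Q Qb.
Proof.
move=> /andP[th0 th12] KL.
suff [C [tau [t0 t1 ev]]] : exists C tau : R, [/\ 0 < tau, tau < 1 &
    \forall t \near \oo, norm2 (Q t - Qb) <= C * tau ^+ t].
  have tp t : (0 <= t)%N -> 0 < tau ^+ t by move=> _; rewrite exprn_gt0.
  have [C' C'0 H] := eventually_le_all tp ev.
  by exists C', tau; split => [||t]; [|rewrite (ltW t0)|exact: H].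
have [/stationary_rate st|r0] := dichotomy.
  by exists 0, (1 / 2); split; [lra|lra|exact: st].
have th01 : 0 < theta < 1 by apply/andP; split; lra.
have [b b0 [T _ bT]] := KL_recurrence th01 KL r0.
have cvT : (fun t => Q (t + T)%N) @ \oo --> Qb by rewrite cvg_shiftn.
have r01 t : 0 < r (t + T)%N <= 1.
  by rewrite r0; have [] := bT (t + T)%N (leq_addl _ _).
(* Since the gap is at most 1, r^(1/2) <= r^theta, so theta may be raised to 1/2. *)
have klT t : r (t.+1 + T)%N `^ (1 / 2) <= b * `|Q (t.+1 + T)%N - Q (t + T)%N|.
  have [_] := bT (t + T)%N (leq_addl _ _); apply: le_trans.
  by apply: ger_powR => //; exact: r01.
have hl : 1 / 2 <= (1 / 2 : R) < 1 by rewrite lexx/=; lra.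
have l40 : 0 < lambda / 4 by rewrite divr_gt0.
have [C [tau [C0 /andP[t0 t1] H]]] := KL_linear_rate l40 b0 hl cvT r01
  (fun t => r_decrease (t + T)) klT erefl.
(* Dividing by tau^(T+1) undoes the shift by T and the extra index in the bound on u_(t+1); sqrt N
   converts the sup norm to the Euclidean one. *)
exists (Num.sqrt N%:R * (C / tau ^+ T.+1)), tau; split => //.
exists T.+1 => // t /= Tt.
rewrite (le_trans (norm2_le _))// -mulrA ler_wpM2l ?sqrtr_ge0//.
have := H (t - T.+1)%N; rewrite addSnnS subnK// => /le_trans; apply.
by rewrite -{2}(subnK Tt) exprD mulrAC -!mulrA mulfV ?mulr1// gt_eqF// exprn_gt0.
Qed.

Lemma proximal_sublinear_rate theta : 1 / 2 < theta < 1 ->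
  KL_exponent cube (G Psi p) Qb theta ->
  exists2 C : R, 0 <= C & forall t : nat, (1 <= t)%N ->
    norm2 (Q t - Qb) <= C * t%:R `^ (- ((1 - theta) / (2 * theta - 1))).
Proof.
move=> /andP[th12 th1] KL; set be := (1 - theta) / _.
have be0 : 0 <= be by rewrite divr_ge0//; lra.
suff [C ev] : exists C : R,
    \forall t \near \oo, norm2 (Q t - Qb) <= C * t%:R `^ (- be).
  by apply: eventually_le_all ev => t t1; rewrite powR_gt0// ltr0n.
have [/stationary_rate st|r0] := dichotomy; first by exists 0; exact: st.
have th01 : 0 < theta < 1 by apply/andP; split; lra.
have [b b0 [T _ bT]] := KL_recurrence th01 KL r0.
have cvT : (fun t => Q (t + T)%N) @ \oo --> Qb by rewrite cvg_shiftn.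
have r01 t : 0 < r (t + T)%N <= 1.
  by rewrite r0; have [] := bT (t + T)%N (leq_addl _ _).
have klT t : r (t.+1 + T)%N `^ theta <= b * `|Q (t.+1 + T)%N - Q (t + T)%N|.
  by have [_] := bT (t + T)%N (leq_addl _ _).
have hl : (1 / 2 : R) <= theta < 1 by apply/andP; split; lra.
have l40 : 0 < lambda / 4 by rewrite divr_gt0.
have [C C0 H] := KL_sublinear_rate l40 b0 hl cvT r01
  (fun t => r_decrease (t + T)) klT th12.
(* For t >= 2(T+1) one has t - (T+1) >= t/2, so the shift costs only the factor (1/2)^(-be). *)
exists (Num.sqrt N%:R * (C * 2^-1 `^ (- be))).
exists (2 * T.+1)%N => // t /= Tt.
rewrite (le_trans (norm2_le _))// -!mulrA ler_wpM2l ?sqrtr_ge0//.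
have tT : (T.+1 <= t)%N by rewrite (leq_trans _ Tt)// mul2n -addnn leq_addr.
have tT0 : (0 < t - T.+1)%N.
  by rewrite subn_gt0 (leq_trans _ Tt)// mul2n -addnn -addn1 leq_add2l.
have := H (t - T.+1)%N tT0; rewrite addSnnS subnK// => /le_trans; apply.
rewrite ler_wpM2l// -powRM// !powRN lef_pV2 ?posrE ?powR_gt0 ?mulr_gt0 ?ltr0n ?(leq_trans _ tT)//.
apply: ge0_ler_powR => //; rewrite ?nnegrE ?mulr_ge0//.
rewrite ler_pdivrMl// -natrM ler_nat mulnBr leq_subRL.
  by rewrite [leqRHS]mul2n -addnn leq_add2r.
by rewrite leq_mul2l.
Qed.

(** On the cube the partial derivatives have a closed form, differentiable at [Qb], which serves as
    the gradient [g] of the nondegenerate case. *)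
Lemma KL_half_of_posdef : posdef (hessian (G Psi p) Qb) ->
  grad (G Psi p) Qb = 0 -> KL_exponent cube (G Psi p) Qb (1 / 2).
Proof.
move=> pd g0.
apply: (@KL_half_of_nondegenerate _ _ _ _ _
  (fun i P => dOmega Psi i P + (logit (P 0 i) - logit (p 0 i)))) => //.
- exact: open_cube.
- by move=> y; exact: differentiable_G.
- by move=> y cy i; exact: partial_G.
- move=> i; apply: differentiableD; first exact: differentiable_dOmega.
  apply: differentiableB => //.
  apply: (@differentiable_comp _ _ _ _ (fun P : 'rV[R]_N => P 0 i : R) (@logit R)).
    exact: differentiable_coord.
  exact/derivable1_diffP/derivable_logit.
- exact: posdef_unitmx.
Qed.

End ProximalConvergence.

Theorem corollary14 (R : realType) (N : nat) (hN : (0 < N)%N)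
    (Psi : {ffun 'I_N -> bool} -> R)
    (p0 : 'rV[R]_N) (hp0 : cube p0)
    (lambda : R) (hlambda : 0 < lambda)
    (Q : nat -> 'rV[R]_N) (hQ : proximal_sequence Psi p0 lambda Q)
    (Qbar : 'rV[R]_N) (hQbar : Q @ \oo --> Qbar)
    (hcrit : critical_point cube (G Psi p0) Qbar) :
  (forall theta : R, 0 < theta < 1 ->
     KL_exponent cube (G Psi p0) Qbar theta ->
     (theta <= 1 / 2 -> linear_rate Q Qbar) /\
     (1 / 2 < theta ->
        exists2 C : R, 0 <= C & forall t : nat, (1 <= t)%N ->
          norm2 (Q t - Qbar)
            <= C * t%:R `^ (- ((1 - theta) / (2 * theta - 1)))))
  /\
  ((forall P : 'rV[R]_N, local_min cube (G Psi p0) P ->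
      posdef (hessian (G Psi p0) P)) ->
   local_min cube (G Psi p0) Qbar ->
   KL_exponent cube (G Psi p0) Qbar (1 / 2) /\ linear_rate Q Qbar).
Proof.
have [cQbar grad0] := hcrit; split=> [theta /andP[th0 th1] KL|pd min].
  split=> [th|th].
    by apply: (proximal_linear_rate hp0 hlambda hQ hQbar cQbar _ KL); exact/andP.
  by apply: (proximal_sublinear_rate hp0 hlambda hQ hQbar cQbar _ KL); exact/andP.
have KL := KL_half_of_posdef hp0 cQbar (pd _ min) grad0.
split=> //; apply: (proximal_linear_rate hp0 hlambda hQ hQbar cQbar _ KL).
by rewrite lexx andbT; lra.
Qed.
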